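(* Let $(X,\mathcal{E})$ be a measurable space. Let $X_\triangleleft$ be the set of all measures on $(X,\mathcal{E})$ taking only values in $\mathbb{N}=\{0,1,2,\ldots\}$, and let $\mathcal{E}_\triangleleft=\sigma(\mathcal{E}_\Diamond)$, where $\mathcal{E}_\Diamond$ is the set of all subsets of $X_\triangleleft$ of the form $\{p\in X_\triangleleft : p(E)=k\}$ with $E\in\mathcal{E}$ and $k\in\mathbb{N}$. If $(X,\mathcal{E})$ is a type $\mathcal{B}$ space then so is $(X_\triangleleft,\mathcal{E}_\triangleleft)$.
   Context: A measurable space is a pair $(X,\mathcal{E})$ with $X$ a non-empty set and $\mathcal{E}$ a $\sigma$-algebra of subsets of $X$; it is countably generated if $\mathcal{E}=\sigma(\mathcal{S})$ for some countable $\mathcal{S}\subset\mathcal{E}$. A mapping $f:(X,\mathcal{E})\to(Y,\mathcal{F})$ is exactly measurable if $f^{-1}(\mathcal{F})=\mathcal{E}$, where $f^{-1}(\mathcal{F})=\{f^{-1}(F):F\in\mathcal{F}\}$. Let $\mathsf{M}=\{0,1\}^{\mathbb{N}}$ with the product topology ($\{0,1\}$ discrete) and let $\mathcal{B}$ be its Borel $\sigma$-algebra. A countably generated measurable space $(X,\mathcal{E})$ is a type $\mathcal{B}$ space if there exists an exactly measurable mapping $f:(X,\mathcal{E})\to(\mathsf{M},\mathcal{B})$ with $f(X)\in\mathcal{B}$. *)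

(* Defs.v *)
From HB Require Import structures.
From mathcomp Require Import all_boot all_order all_algebra.
From mathcomp Require Import all_classical all_reals all_analysis.

Set Implicit Arguments.
Unset Strict Implicit.
Unset Printing Implicit Defensive.

Import Order.TTheory GRing.Theory Num.Theory.

Local Open Scope classical_set_scope.
Local Open Scope ring_scope.
Local Open Scope ereal_scope.

(* A measurable space (X, E) with X non-empty is a [measurableType]: in the
   library such a type is pointed. *)

Definition countably_generated d (T : measurableType d) : Prop :=
  exists S : set (set T),
    [/\ countable S, S `<=` d.-measurable & d.-measurable = <<s S >>].

Definition exactly_measurable d1 d2 (T1 : measurableType d1)
    (T2 : measurableType d2) (f : T1 -> T2) : Prop :=
  [set f @^-1` F | F in d2.-measurable] = d1.-measurable.

(* {0,1}^N with the sigma-algebra generated by the open sets of the product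
   topology. *)
Notation borel_cantor := (g_sigma_algebraType (@open cantor_space)).

Definition type_B d (T : measurableType d) : Prop :=
  countably_generated T /\
  exists f : T -> borel_cantor,
    exactly_measurable f /\ measurable (range f).

(* A library measure on T is a function on all of [set T] whose values off the
   sigma-algebra are unconstrained. Fixing them to 0 makes the elements of
   [nat_measure] correspond one-to-one to the measures with domain the
   sigma-algebra (lemmas [nat_measure_ext] and [nat_measure_exists]). *)
Record nat_measure d (T : measurableType d) (R : realType) := NatMeasure {
  nat_measure_val :> {measure set T -> \bar R} ;
  nat_measureP : forall A, measurable A -> exists k : nat,
    nat_measure_val A = k%:R%:E ;
  nat_measure_off : forall A, ~ measurable A -> nat_measure_val A = 0 }.

Lemma nat_measure_ext d (T : measurableType d) (R : realType)
    (p q : nat_measure T R) :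
  (forall A, measurable A -> p A = q A) -> p = q.
Proof.
case: p q => [p pN p0] [q qN q0] /= pq.
have e : p = q.
  apply/eq_measure/funext => A.
  by have [mA|mA] := pselect (measurable A); [exact: pq|rewrite p0// q0].
by move: pN p0; rewrite e => pN p0; congr NatMeasure; exact: Prop_irrelevance.
Qed.

Section nat_measure_exists.
Context d (T : measurableType d) (R : realType).
Variable mu : {measure set T -> \bar R}.

Let nu (A : set T) : \bar R := if `[< measurable A >] then mu A else 0.

Let nuE A : measurable A -> nu A = mu A.
Proof. by rewrite /nu => /asboolT ->. Qed.

Let nu0 : nu set0 = 0.
Proof. by rewrite nuE ?measure0. Qed.

Let nu_ge0 A : 0 <= nu A.
Proof. by rewrite /nu; case: ifP. Qed.

Let nu_semi_sigma_additive : semi_sigma_additive nu.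
Proof.
move=> F mF tF mUF; rewrite nuE//; under eq_fun do under eq_bigr do rewrite nuE//.
exact: measure_semi_sigma_additive.
Qed.

HB.instance Definition _ := isMeasure.Build d T R nu
  nu0 nu_ge0 nu_semi_sigma_additive.

Lemma nat_measure_exists :
  (forall A, measurable A -> exists k : nat, mu A = k%:R%:E) ->
  exists p : nat_measure T R, forall A, measurable A -> p A = mu A.
Proof.
move=> muN.
have nuN A : measurable A -> exists k : nat, nu A = k%:R%:E.
  by move=> mA; rewrite nuE//; exact: muN.
have nuoff A : ~ measurable A -> nu A = 0 by rewrite /nu => /asboolF ->.
by exists (@NatMeasure d T R nu nuN nuoff) => A mA; exact: nuE.
Qed.

End nat_measure_exists.

Section nat_measure_space.
Context d (T : measurableType d) (R : realType).

Let nat_measure_zero : nat_measure T R.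
Proof. by apply: (@NatMeasure d T R mzero) => // A mA; exists 0%N. Defined.

HB.instance Definition _ := gen_eqMixin (nat_measure T R).
HB.instance Definition _ := gen_choiceMixin (nat_measure T R).
HB.instance Definition _ := isPointed.Build (nat_measure T R) nat_measure_zero.

Definition nat_measure_diamond : set (set (nat_measure T R)) :=
  [set [set p : nat_measure T R | p A = k%:R%:E] |
    A in d.-measurable & k in [set: nat]].

End nat_measure_space.

Notation nat_measure_space T R :=
  (g_sigma_algebraType (@nat_measure_diamond _ T R)).

(* Main.v *)
Require Import Defs.
From mathcomp Require Import all_boot all_order all_algebra.
From mathcomp Require Import all_classical all_reals all_analysis.
From mathcomp Require Import zify.

Set Implicit Arguments.
Unset Strict Implicit.
Unset Printing Implicit Defensive.

Import GRing.Theory Num.Theory.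

Local Open Scope classical_set_scope.

(** An integer-valued measure on a type B space is, seen in the Cantor space,
    a finite sum of point masses, and the positions of these point masses can
    be computed measurably from the masses of the cylinders.

    Let [f : X -> {0,1}^N] be exactly measurable with Borel range [B]. A measure
    [p] on [X] gives the natural numbers [m s = p (f^-1 (cylinder s))], indexed
    by the nodes [s] of the binary tree. They are recorded as a point of the
    Cantor space, with one bit for each statement [m s = k]: [measure_code].
    Its bits are generators of the sigma-algebra on measures, so that
    [measure_code] is measurable.

    Conversely, an additive [m] with natural values is the content of a sum of
    [m [::]] point masses: the [i]-th atom in lexicographic order is found by
    walking down the tree, skipping a left subtree when it contains too few
    atoms ([atom], [atom_count_cylinder]). Each bit of an atom depends
    on finitely many values of [m], hence is a Borel function of the code. By
    uniqueness of finite measures that agree on cylinders, for every Borel set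
    [F] the mass [p (f^-1 F)] is the number of atoms in [F] ([mass_preimage]).
    The theorem follows from this formula in three ways.

    - The set of the [p] with [p (f^-1 F) = k] is the preimage under
      [measure_code] of a Borel condition on codes, because counting atoms in
      [F] is Borel ([dmeasurable_atom_count]). As every measurable set of [X] is
      some [f^-1 F], [measure_code] is exactly measurable.
    - No atom of a code of a measure lies outside [B], and if all the atoms of a
      point [z] lie in [B], then they can be lifted to [X] and the sum of the
      point masses there has the same cylinder masses. So the range of
      [measure_code] consists of the [z] that have no atom outside [B] and that
      are the code of their own atom counts ([range_measure_code]). Both
      conditions are Borel.
    - Countable generation is inherited from the Cantor space through any
      exactly measurable map ([exactly_measurable_countably_generated]). *)

(** * Generators of the Borel sigma-algebra of the Cantor space *)

Definition cylinder (s : seq bool) : set cantor_space :=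
  [set y | mkseq y (size s) = s].

(** The empty set makes the family stable under intersection. *)
Definition cylinders : set (set cantor_space) :=
  [set set0] `|` range cylinder.

Definition coordinates : set (set cantor_space) :=
  range (fun n => [set y : cantor_space | y n]).

Lemma mkseq_take (T : Type) (y : nat -> T) (l n : nat) :
  (l <= n)%N -> take l (mkseq y n) = mkseq y l.
Proof. by move=> ln; rewrite /mkseq -map_take take_iota (minn_idPl ln). Qed.

Lemma cylinder_nil : cylinder [::] = setT.
Proof. by apply/seteqP; split. Qed.

Lemma cylinder_mkseq (x y : cantor_space) l :
  cylinder (mkseq x l) y = (mkseq y l = mkseq x l).
Proof. by rewrite /cylinder/= size_mkseq. Qed.

(** Two cylinders are nested or disjoint, according to whether the shorter word
    is a prefix of the longer one. *)
Lemma setI_closed_cylinders : setI_closed cylinders.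
Proof.
have nested (s t : seq bool) :
    (size s <= size t)%N -> cylinders (cylinder s `&` cylinder t).
  move=> st; have [e|ne] := eqVneq (take (size s) t) s.
    right; exists t => //; apply/seteqP; split=> [y yt|y []//].
    split=> //; move: yt; rewrite /cylinder/= => yt.
    by rewrite -[RHS]e -yt mkseq_take.
  left; apply/seteqP; split=> // y [ys yt]; move/eqP: ne; apply.
  by move: ys yt; rewrite /cylinder/= => ys yt; rewrite -[RHS]ys -yt mkseq_take.
move=> A B [->|[s _ <-]]; first by rewrite set0I; left.
move=> [->|[t _ <-]]; first by rewrite setI0; left.
by have [/nested//|/ltnW/nested] := leqP (size s) (size t); rewrite setIC.
Qed.

(** The cylinders around [x] are a filter basis, and the filter it generates
    converges to [x] because convergence in the product topology can be tested
    on each coordinate. *)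
Lemma nbhs_cylinder (x : cantor_space) (U : set cantor_space) :
  nbhs x U -> exists l, cylinder (mkseq x l) `<=` U.
Proof.
have cylinderS l l' : (l <= l')%N ->
    cylinder (mkseq x l') `<=` cylinder (mkseq x l).
  move=> ll' y; rewrite !cylinder_mkseq => e.
  by rewrite -(mkseq_take y ll') e mkseq_take.
pose F : set_system cantor_space :=
  [set V | exists l, cylinder (mkseq x l) `<=` V].
have FF : Filter F.
  split; first by exists 0%N.
    move=> P Q [l Pl] [l' Ql']; exists (maxn l l') => y yl.
    by split; [apply: Pl|apply: Ql']; apply: cylinderS yl;
      rewrite ?leq_maxl ?leq_maxr.
  by move=> P Q PQ [l Pl]; exists l => y /Pl/PQ.
suff : F --> x by apply.
apply/cvg_sup => i V [_ [[B oB <-] Bx] BV].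
exists i.+1 => y; rewrite cylinder_mkseq => e; apply: BV => /=.
suff -> : y i = x i by [].
by rewrite -(nth_mkseq false y (ltnSn i)) e nth_mkseq.
Qed.

Lemma open_coordinates : coordinates `<=` @open cantor_space.
Proof.
move=> _ [n _ <-].
have projC := @proj_continuous nat (fun=> bool) n.
by apply: ((continuousP (_ : cantor_space -> bool)).1 projC [set b | b]);
  exact: discrete_open.
Qed.

Lemma coordinates_cylinder s : <<s coordinates >> (cylinder s).
Proof.
have -> : cylinder s =
    \bigcap_(i in `I_(size s)) [set y : cantor_space | y i = nth false s i].
  apply/seteqP; split=> y; rewrite /cylinder/=.
    by move=> e i /= si; rewrite -[in RHS]e nth_mkseq.
  move=> e; apply: (@eq_from_nth _ false); rewrite ?size_mkseq// => i si.
  by rewrite nth_mkseq// e.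
apply: (@bigcap_measurableType _ (g_sigma_algebraType coordinates)) => i _.
have mi : (@measurable _ (g_sigma_algebraType coordinates))
    [set y : cantor_space | y i] by apply: sub_sigma_algebra; exists i.
case: (nth false s i); first exact: mi.
rewrite [X in measurable X](_ : _ = ~` [set y : cantor_space | y i]).
  exact: measurableC.
by apply/seteqP; split=> y /=; case: (y i).
Qed.

(** An open set is the union of the cylinders it contains, and there are
    countably many cylinders. *)
Lemma cylinders_open : @open cantor_space `<=` <<s cylinders >>.
Proof.
move=> U oU.
have -> : U = \bigcup_(s : seq bool)
    (if `[< cylinder s `<=` U >] then cylinder s else set0).
  apply/seteqP; split=> [x Ux|x [s _]]; last by case: asboolP => // + sx; exact.
  have [l lU] : exists l, cylinder (mkseq x l) `<=` U.
    by apply: nbhs_cylinder; exact: open_nbhs_nbhs.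
  by exists (mkseq x l) => //; rewrite asboolT// cylinder_mkseq.
apply: (@countable_bigcupT_measurable _ (g_sigma_algebraType cylinders)) => //.
move=> s; case: ifPn => _; apply: sub_sigma_algebra; first by right; exists s.
by left.
Qed.

(** Coordinates are the convenient generators for proving that a map into the
    Cantor space is measurable; cylinders, being stable under intersection, are
    those needed for uniqueness of measures. *)
Lemma borel_cantor_coordinates :
  @measurable _ borel_cantor = <<s coordinates >>.
Proof.
apply/seteqP; split; last exact: sub_sigma_algebra2 open_coordinates.
apply: smallest_sub; first exact: smallest_sigma_algebra.
move=> U /cylinders_open; apply: smallest_sub U.
  exact: smallest_sigma_algebra.
move=> _ [->|[s _ <-]]; last exact: coordinates_cylinder.
exact: sigma_algebra0.
Qed.

Lemma borel_cantor_cylinders : @measurable _ borel_cantor = <<s cylinders >>.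
Proof.
apply/seteqP; split; first exact: smallest_sub cylinders_open.
rewrite borel_cantor_coordinates.
apply: smallest_sub; first exact: smallest_sigma_algebra.
move=> _ [->|[s _ <-]]; last exact: coordinates_cylinder.
exact: sigma_algebra0.
Qed.

Lemma measurable_cylinder s : @measurable _ borel_cantor (cylinder s).
Proof. by rewrite borel_cantor_coordinates; exact: coordinates_cylinder. Qed.

(** Taking preimages commutes with generating sigma-algebras, so the preimages
    of the countably many coordinates generate. *)
Lemma exactly_measurable_countably_generated d (T : measurableType d)
    (f : T -> borel_cantor) :
  exactly_measurable f -> countably_generated T.
Proof.
move=> fex; exists (preimage_set_system setT f coordinates).
have gen : d.-measurable = <<s preimage_set_system setT f coordinates >>.
  rewrite (@g_sigma_preimageE _ cantor_space) -fex.
  transitivity (preimage_set_system setT f (@measurable _ borel_cantor)).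
    by apply: eq_imagel => F _; rewrite setTI.
  by rewrite borel_cantor_coordinates.
split=> //.
- apply: sub_countable (card_image_le _ _) _.
  exact: sub_countable (card_image_le _ _) (countableP _).
- by rewrite gen; exact: sub_sigma_algebra.
Qed.

(** * Measurable maps into countable sets *)

(** Measurability with respect to the discrete sigma-algebra of [C], without
    requiring a measurable structure on [C]. *)
Definition dmeasurable d (T : measurableType d) (C : Type) (h : T -> C) :=
  forall A : set C, measurable (h @^-1` A).

Section dmeasurable.
Context d (T : measurableType d).

Lemma dmeasurable_cst (C : Type) (c : C) : dmeasurable (fun _ : T => c).
Proof.
by move=> A; rewrite preimage_cst; case: ifP.
Qed.

Lemma dmeasurable_bool (h : T -> bool) :
  measurable [set x | h x] -> dmeasurable h.
Proof.
move=> mh A.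
have -> : h @^-1` A = ([set x | h x] `&` [set _ | A true]) `|`
    (~` [set x | h x] `&` [set _ | A false]).
  apply/seteqP; split=> x /=; first by case: (h x); [left|right].
  by case: (h x) => -[] [].
apply: measurableU; apply: measurableI => //;
  first exact: (dmeasurable_cst true).
  exact: measurableC.
exact: (dmeasurable_cst false).
Qed.

(** Everything that is computed from countably-valued measurable maps is
    handled by this one closure property: condition on the value of [h]. *)
Lemma dmeasurable_bind (C : countType) (D : Type) (h : T -> C)
    (k : C -> T -> D) :
  dmeasurable h -> (forall c, dmeasurable (k c)) ->
  dmeasurable (fun x => k (h x) x).
Proof.
move=> mh mk A.
have -> : (fun x => k (h x) x) @^-1` A =
    \bigcup_c (h @^-1` [set c] `&` k c @^-1` A).
  by apply/seteqP; split=> [x Ax|x [c _ [/= <-]]//]; exists (h x).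
apply: countable_bigcupT_measurable => // c.
apply: measurableI; first exact: mh.
exact: mk.
Qed.

Lemma dmeasurable_comp (C : countType) (D : Type) (h : T -> C) (k : C -> D) :
  dmeasurable h -> dmeasurable (k \o h).
Proof. by move=> mh A; rewrite comp_preimage; exact: mh. Qed.

Lemma dmeasurable_comp2 (C C' : countType) (D : Type) (h : T -> C)
    (h' : T -> C') (k : C -> C' -> D) :
  dmeasurable h -> dmeasurable h' -> dmeasurable (fun x => k (h x) (h' x)).
Proof.
move=> mh mh'; apply: (dmeasurable_bind (k := fun c x => k c (h' x))) => // c.
exact: (dmeasurable_comp (k c)).
Qed.

Lemma dmeasurable_sum n (h : nat -> T -> nat) :
  (forall i, dmeasurable (h i)) -> dmeasurable (fun x => \sum_(i < n) h i x)%N.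
Proof.
move=> mh; elim: n => [|n IHn].
  by under eq_fun do rewrite big_ord0; exact: dmeasurable_cst.
under eq_fun do rewrite big_ord_recr/=.
exact: (dmeasurable_comp2 addn IHn (mh n)).
Qed.

End dmeasurable.

(** Choosing the least witness, rather than an arbitrary one, is what makes the
    selection depend measurably on [P] ([dmeasurable_least]). *)
Definition least (P : nat -> bool) : nat :=
  if pselect (exists k, P k) is left eP then ex_minn eP else 0%N.

Lemma least_unique (P : nat -> bool) k :
  (forall j, P j = (j == k)) -> least P = k.
Proof.
move=> Pk; rewrite /least; case: pselect => [eP|[]]; last first.
  by exists k; rewrite Pk.
by case: ex_minnP => j; rewrite Pk => /eqP.
Qed.

(** The least [k] is determined by countably many bits: those of rank at most
    [k], or all of them when there is no witness. *)
Lemma dmeasurable_least d (T : measurableType d) (h : nat -> T -> bool) :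
  (forall k, dmeasurable (h k)) -> dmeasurable (fun x => least (h ^~ x)).
Proof.
move=> mh A.
have mcst (P : Prop) : measurable [set _ : T | P].
  exact: (@dmeasurable_cst _ T _ tt [set _ | P]).
have -> : (fun x => least (h ^~ x)) @^-1` A =
    (\bigcup_k ([set x | h k x] `&` [set _ | A k] `&`
       \bigcap_(j in `I_k) [set x | ~~ h j x])) `|`
    (\bigcap_k [set x | ~~ h k x] `&` [set _ | A 0%N]).
  apply/seteqP; split=> x /=; rewrite /least.
    case: pselect => [eP|nP] Ax; last first.
      by right; split=> // k _; apply/negP => hk; apply: nP; exists k.
    left; move: Ax; case: ex_minnP => k hk kmin Ak.
    exists k => //; split=> // j /=.
    by move=> jk; apply/negP => /kmin; rewrite leqNgt jk.
  case: pselect => [eP|nP].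
    case: ex_minnP => k hk kmin [[j _ [[/= hj Aj] jmin]]|[nh _]]; last first.
      by have := nh k Logic.I; rewrite /= hk.
    suff -> : k = j by [].
    apply/eqP; rewrite eqn_leq kmin//= leqNgt; apply/negP => /jmin /=.
    by rewrite hk.
  by case=> [[j _ [[/= hj]]]|[]//]; case: nP; exists j.
apply: measurableU.
  apply: bigcupT_measurable => k.
  apply: measurableI; first apply: measurableI => //.
    exact: (mh k [set b | b]).
  apply: bigcap_measurableType => j _; exact: (mh j [set b | ~~ b]).
apply: measurableI => //; apply: bigcapT_measurable => k.
exact: (mh k [set b | ~~ b]).
Qed.
(** * The atoms of an integer-valued content on the binary tree *)

Section atoms.
Variable m : seq bool -> nat.

(** One step of the descent towards the [j]-th atom, in lexicographic order,
    below the node [s]: the atoms in the left subtree come first. *)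
Definition step (sj : seq bool * nat) : seq bool * nat :=
  let: (s, j) := sj in
  let a := m (rcons s false) in
  if (j < a)%N then (rcons s false, j) else (rcons s true, j - a)%N.

Definition walk (i l : nat) : seq bool * nat := iter l step ([::], i).

Definition atom (i : nat) : cantor_space := fun l => last false (walk i l.+1).1.

Definition atom_count (F : set cantor_space) : nat :=
  (\sum_(i < m [::]) `[< F (atom i) >])%N.

Lemma mkseq_atom i l : mkseq (atom i) l = (walk i l).1.
Proof.
elim: l => // l IHl; rewrite mkseqS IHl /atom /walk iterS -/(walk i l).
by case: (walk i l) => s j; rewrite /step; case: ifP; rewrite /= last_rcons.
Qed.

Hypothesis m_additive :
  forall s, m s = (m (rcons s false) + m (rcons s true))%N.

(** The lexicographic numbering gives the atoms of a cylinder consecutive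
    numbers, starting at some [u]. Splitting the node cuts its interval in two,
    by additivity. The second component of the walk, which is the rank inside
    the interval, is what makes the induction go through. *)
Lemma walk_interval s : exists u, (u + m s <= m [::])%N /\
  forall i, (i < m [::])%N ->
    ((walk i (size s)).1 == s) = (u <= i < u + m s)%N /\
    ((u <= i < u + m s)%N -> walk i (size s) = (s, i - u)%N).
Proof.
elim/last_ind: s => [|s b [u [um IHs]]].
  by exists 0%N; split=> // i im; rewrite /= subn0 im.
have ms := m_additive s.
exists (if b then u + m (rcons s false) else u)%N; split.
  by case: b; lia.
move=> i im; have [ws wE] := IHs i im.
rewrite size_rcons /walk iterS -/(walk i (size s)).
have [iI|iI] := boolP (u <= i < u + m s)%N.
  rewrite wE//= /step; case: ifP => ia; case: b;
    rewrite /= ?eqseq_rcons ?eqxx /=;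
    split; try lia; move=> _; congr pair; lia.
have {ws}/negPf nws : (walk i (size s)).1 != s by rewrite ws.
have -> : (if b then u + m (rcons s false) else u) <= i <
    (if b then u + m (rcons s false) else u) + m (rcons s b) = false.
  by case: b; lia.
split=> //; move: nws; case: (walk i (size s)) => t j /= nts.
by rewrite /step; case: ifP => _ /=; rewrite eqseq_rcons nts.
Qed.

(** Every additive [m] is thus the content of the sum of the point masses at its
    atoms: the count is the length of the interval of [walk_interval]. *)
Lemma atom_count_cylinder s : atom_count (cylinder s) = m s.
Proof.
have [u [um /= uP]] := walk_interval s.
transitivity (\sum_(i < m [::]) (u <= i < u + m s))%N.
  apply: eq_bigr => i _; congr nat_of_bool; rewrite -(uP i (ltn_ord i)).1.
  by rewrite -mkseq_atom; apply/asboolP/eqP.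
rewrite -(big_mkord xpredT (fun i => nat_of_bool (u <= i < u + m s)))%N.
rewrite (@big_cat_nat _ _ _ u)//=; last by lia.
rewrite (@big_cat_nat _ _ _ (u + m s) u)//= ?leq_addr//.
rewrite big_nat big1 ?add0n; last by move=> i ?; lia.
rewrite [X in (_ + X)%N]big_nat [X in (_ + X)%N]big1 ?addn0; last first.
  by move=> i ?; lia.
rewrite big_nat (eq_bigr (fun=> 1%N)); last by move=> i ?; lia.
by rewrite -big_nat sum_nat_const_nat muln1; lia.
Qed.

End atoms.

(** * Coding integer-valued functions on the tree by infinite words *)

(** There is one bit for each pair [(s, k)], rather than a binary expansion of
    [m s], so that for the cylinder masses of a measure each bit is the
    indicator of a generator of the sigma-algebra on measures. *)
Definition tree_code (m : seq bool -> nat) : cantor_space := fun n =>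
  if @unpickle (seq bool * nat)%type n is Some (s, k) then m s == k else false.

Definition tree_decode (z : cantor_space) (s : seq bool) : nat :=
  least (fun k => z (pickle (s, k))).

Lemma tree_codeK : cancel tree_code tree_decode.
Proof.
move=> m; apply/funext => s; apply: least_unique => k.
by rewrite /tree_code pickleK eq_sym.
Qed.

Lemma dmeasurable_coordinate n :
  dmeasurable (fun z : borel_cantor => (z : cantor_space) n).
Proof.
apply: dmeasurable_bool; rewrite borel_cantor_coordinates.
by apply: sub_sigma_algebra; exists n.
Qed.

Lemma dmeasurable_tree_decode s :
  dmeasurable (fun z : borel_cantor => tree_decode z s).
Proof. by apply: dmeasurable_least => k; exact: dmeasurable_coordinate. Qed.

(** Each step of the walk consults a single value of the decoded function. *)
Lemma dmeasurable_walk i l :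
  dmeasurable (fun z : borel_cantor => walk (tree_decode z) i l).
Proof.
elim: l => [|l IHl]; first exact: dmeasurable_cst.
apply: (dmeasurable_bind
  (k := fun sj (z : borel_cantor) => step (tree_decode z) sj) IHl) => -[s j].
exact: (dmeasurable_comp (fun a =>
  if j < a then (rcons s false, j) else (rcons s true, j - a))%N
  (dmeasurable_tree_decode (rcons s false))).
Qed.

Lemma measurable_atom i :
  measurable_fun setT
    (fun z : borel_cantor => atom (tree_decode z) i : borel_cantor).
Proof.
apply: (@measurability _ _ borel_cantor borel_cantor setT _ coordinates
  borel_cantor_coordinates).
move=> _ [_ [n _ <-] <-]; rewrite setTI.
exact: (dmeasurable_comp (fun sj => last false sj.1)
  (dmeasurable_walk i n.+1) [set b | b]).
Qed.

Lemma dmeasurable_atom_count (F : set borel_cantor) : measurable F ->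
  dmeasurable (fun z : borel_cantor => atom_count (tree_decode z) F).
Proof.
move=> mF; apply: (dmeasurable_bind (k := fun n (z : borel_cantor) =>
  \sum_(i < n) `[< F (atom (tree_decode z) i) >])%N
  (dmeasurable_tree_decode [::])) => n.
apply: (@dmeasurable_sum _ _ n (fun i (z : borel_cantor) =>
  nat_of_bool `[< F (atom (tree_decode z) i) >])) => i.
apply: (dmeasurable_comp nat_of_bool
  (h := fun z : borel_cantor => `[< F (atom (tree_decode z) i) >])).
apply: dmeasurable_bool.
have := measurable_atom i measurableT mF; rewrite setTI.
by congr (measurable _); apply/seteqP; split=> z /asboolP.
Qed.

(** * Integer-valued measures *)

Definition mass (T : Type) (R : realType) (mu : set T -> \bar R) (A : set T) :
  nat := Num.truncn (fine (mu A)).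

Lemma massE (T : Type) (R : realType) (mu : set T -> \bar R) A k :
  mu A = k%:R%:E -> mass mu A = k.
Proof. by rewrite /mass => ->; rewrite /= natrK. Qed.

(** The conventional value 0 off the sigma-algebra makes this hold for every
    set. *)
Lemma nat_measureE d (T : measurableType d) (R : realType)
    (p : nat_measure T R) A : p A = (mass p A)%:R%:E.
Proof.
have [mA|nA] := pselect (measurable A).
  by have [k pk] := nat_measureP p mA; rewrite (massE pk).
have p0 := nat_measure_off p nA.
by rewrite (@massE _ _ _ _ 0%N).
Qed.

Lemma msum_diracE d (T : measurableType d) (R : realType) (x : nat -> T) n A :
  msum (fun i => dirac (x i)) n A =
  (\sum_(i < n) `[< A (x i) >])%N%:R%:E :> \bar R.
Proof.
rewrite /msum natr_sum -sumEFin; apply: eq_bigr => i _.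
by rewrite /= diracE; congr (_%:R%:E); congr nat_of_bool.
Qed.

Section coding.
Context d (X : measurableType d) (R : realType) (f : X -> borel_cantor).
Hypothesis mf : measurable_fun setT f.
Implicit Types p : nat_measure X R.

Definition cylinder_mass p (s : seq bool) : nat := mass p (f @^-1` cylinder s).

Lemma measurable_preimage (F : set borel_cantor) :
  measurable F -> measurable (f @^-1` F).
Proof. by move=> mF; rewrite -[X in measurable X]setTI; exact: mf. Qed.

Lemma cylinder_mass_additive p s :
  cylinder_mass p s =
  (cylinder_mass p (rcons s false) + cylinder_mass p (rcons s true))%N.
Proof.
have mcyl t := measurable_preimage (measurable_cylinder t).
apply: massE; rewrite natrD EFinD -!nat_measureE -measureU//; last first.
  apply/seteqP; split=> // x [] /=.
  rewrite /cylinder/= !size_rcons !mkseqS => /rcons_inj[_ ->].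
  by move=> /rcons_inj[].
congr (_ _); apply/seteqP.
split=> x /=; rewrite /cylinder/= !size_rcons !mkseqS.
  by move=> ->; case: (f x _); [right|left].
by case=> /rcons_inj[].
Qed.

(** The image of [p] under [f] and the sum of the point masses at the atoms are
    finite measures with the same values on cylinders, hence are equal. *)
Lemma mass_preimage p (F : set borel_cantor) : measurable F ->
  mass p (f @^-1` F) = atom_count (cylinder_mass p) F.
Proof.
move=> mF; apply: massE.
pose m := cylinder_mass p.
pose nu : {measure set borel_cantor -> \bar R}%R :=
  measure_function_pushforward__canonical__measure_function_Measure p mf.
rewrite -[LHS]/(nu F) /atom_count.
rewrite -(@msum_diracE _ borel_cantor R (fun i => atom m i : borel_cantor)).
apply: (@measure_unique _ R borel_cantor cylinders (fun=> setT)) F mF.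
- exact: borel_cantor_cylinders.
- exact: setI_closed_cylinders.
- by move=> _; right; exists [::] => //; exact: cylinder_nil.
- by rewrite bigcup_const.
- move=> A [->|[s _ <-]]; first by rewrite !measure0.
  rewrite [RHS]msum_diracE; apply: etrans (nat_measureE p _) _.
  congr (_%:R%:E).
  exact/esym/(atom_count_cylinder (cylinder_mass_additive p)).
- by move=> _; rewrite /= /pushforward nat_measureE ltry.
Qed.

Definition measure_code (p : nat_measure_space X R) : borel_cantor :=
  tree_code (cylinder_mass p).

(** A bit is the indicator of a generator of the sigma-algebra on measures, or
    is constant if its number is that of no pair. *)
Lemma measurable_measure_code : measurable_fun setT measure_code.
Proof.
apply: (@measurability _ _ (nat_measure_space X R) borel_cantor setT _
  coordinates borel_cantor_coordinates).
move=> _ [_ [n _ <-] <-]; rewrite setTI.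
rewrite /preimage/= /measure_code /tree_code.
case: unpickle => [[s k]|] /=; last first.
  exact: (@dmeasurable_cst _ (nat_measure_space X R) _ false [set b | b]).
apply: sub_sigma_algebra; exists (f @^-1` cylinder s).
  exact: measurable_preimage (measurable_cylinder s).
exists k => //; apply/seteqP; split=> p /=; first by move=> /massE /eqP.
by rewrite nat_measureE => /eqP <-.
Qed.

(** A generator [p A = k] with [A = f^-1 F] says that the measure has [k] atoms
    in [F], which is a Borel condition on its code. *)
Lemma exactly_measurable_measure_code :
  exactly_measurable f -> exactly_measurable measure_code.
Proof.
move=> fex; apply/seteqP; split=> [_ [F mF <-]|].
  by rewrite -[X in measurable X]setTI; exact: measurable_measure_code.
rewrite (_ : image _ _ = preimage_set_system setT measure_code measurable).
  apply: smallest_sub.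
    exact/sigma_algebra_preimage/sigma_algebra_measurable.
  move=> _ [A mA [k _ <-]]; move: mA; rewrite -fex => -[F mF <-].
  exists ((fun z : borel_cantor => atom_count (tree_decode z) F) @^-1` [set k]).
    exact: (dmeasurable_atom_count mF).
  rewrite setTI; apply/seteqP; split=> p /=.
    by rewrite /measure_code tree_codeK -mass_preimage// nat_measureE => ->.
  by rewrite /measure_code tree_codeK -mass_preimage// => /massE.
by apply: eq_imagel => F _; rewrite setTI.
Qed.

(** Requiring [z] to be the code of its own atom counts expresses at once that
    its bits encode a function on the tree and that this function is
    additive. *)
Lemma range_measure_code : measurable (range f) ->
  range measure_code =
  [set z | atom_count (tree_decode z) (~` range f) = 0%N] `&`
  [set z | z = tree_code (fun s => atom_count (tree_decode z) (cylinder s))].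
Proof.
move=> mB; apply/seteqP; split=> [_ [p _ <-]|z [/= z0 zE]].
  rewrite /= /measure_code tree_codeK; split.
    rewrite -mass_preimage; last exact: measurableC.
    rewrite (_ : _ @^-1` _ = set0).
      by apply: massE; rewrite measure0.
    by apply/seteqP; split=> // x /=; apply; exists x.
  by congr tree_code; apply/funext => s; rewrite atom_count_cylinder//;
    exact: cylinder_mass_additive.
pose m := tree_decode z.
(* Lift the atoms to [X]; numbers beyond the total mass get a default point. *)
have /choice[x xE] i : exists x : X, (i < m [::])%N -> f x = atom m i.
  have [im|im] := ltnP i (m [::]); last by exists point.
  have [[y _ yE]|nB] := pselect (range f (atom m i)); first by exists y.
  move/eqP: z0; rewrite sum_nat_eq0 => /forallP /(_ (Ordinal im)) /=.
  by rewrite asboolT.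
have [|p pE] := @nat_measure_exists _ X R
  (msum (fun i => dirac (x i)) (m [::])).
  by move=> A _; eexists; exact: msum_diracE.
exists p => //; rewrite zE /measure_code; congr tree_code; apply/funext => s.
apply: massE; rewrite pE; last first.
  exact: measurable_preimage (measurable_cylinder s).
apply: etrans (msum_diracE _ _ _ _) _.
by congr (_%:R%:E); apply: eq_bigr => i _; rewrite /preimage/= xE.
Qed.

Lemma measurable_range_measure_code :
  measurable (range f) -> measurable (range measure_code).
Proof.
move=> mB; rewrite range_measure_code//; apply: measurableI.
  exact: (dmeasurable_atom_count (measurableC mB) [set 0%N]).
(* Equality of two sequences of bits is a countable intersection. *)
rewrite [X in measurable X](_ : _ = \bigcap_n [set z : borel_cantor |
    z n == tree_code (fun s => atom_count (tree_decode z) (cylinder s)) n]).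
  apply: bigcapT_measurable => n.
  apply: (dmeasurable_comp2 (fun a b => a == b) (dmeasurable_coordinate n) _
    [set b | b]).
  rewrite /tree_code; case: unpickle => [[s k]|]; last exact: dmeasurable_cst.
  exact: (dmeasurable_comp (fun j => j == k)
    (dmeasurable_atom_count (measurable_cylinder s))).
apply/seteqP; split=> z /= zE; first by move=> n _; apply/eqP; rewrite -zE.
by apply/funext => n; apply/eqP/zE.
Qed.

End coding.

Theorem proposition11p1 (R : realType) (d : measure_display)
    (X : measurableType d) :
  type_B X -> type_B (nat_measure_space X R).
Proof.
move=> [_ [f [fex mB]]].
have mf : measurable_fun setT f.
  by move=> _ F mF; rewrite setTI -fex; exists F.
have gex := exactly_measurable_measure_code R mf fex.
split; first exact: exactly_measurable_countably_generated gex.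
exists (@measure_code _ X R f).
by split=> //; exact: measurable_range_measure_code.
Qed.
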